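(* Let $a,b,c,m$ be positive integers, $\tilde d_m=a+b+c+m/2-2$, and let $\tilde H_{a,b,c}(u,v;m)$ be as in the context. For $u,v\in(-\infty,1)$: $$\tilde H_{a,b,c}(u,v;m+2)=(\tilde d_m+u\partial_u+v\partial_v)\tilde H_{a,b,c}(u,v;m),$$ $$\tilde H_{a,b+1,c}(u,v;m)=b^{-1}\partial_v\tilde H_{a,b,c}(u,v;m),$$ $$\tilde H_{a,b,c+1}(u,v;m)=c^{-1}\partial_u\tilde H_{a,b,c}(u,v;m),$$ and $$\frac{\tilde H_{a+1,b,c}(u,v;m)}{\tilde H_{a,b,c}(u,v;m)}=\frac{\tilde d_m}{a+b+c}\,\frac{F_1(\tilde d_m+1;c,b;a+b+c+1;u,v)}{F_1(\tilde d_m;c,b;a+b+c;u,v)} .$$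
   Context: For positive integers $a,b,c,m$, $$\tilde H_{a,b,c}(u,v;m)=\frac{\Gamma(\tilde d_m)}{\Gamma(a+b+c)}\,F_1\big(\tilde d_m;c,b;a+b+c;u,v\big),\qquad \tilde d_m=\tilde d_m(a,b,c)=a+b+c+\tfrac m2-2 .$$ $F_1$ is Appell's first hypergeometric function, $F_1(\alpha;\beta,\beta';\gamma;x,y)=\sum_{p,q\ge0}\frac{(\alpha)_{p+q}(\beta)_p(\beta')_q}{p!\,q!\,(\gamma)_{p+q}}x^py^q$ for $|x|,|y|<1$, extended to real $x,y<1$ (for $\beta,\beta',\gamma-\beta-\beta'>0$) by $$F_1(\alpha;\beta,\beta';\gamma;x,y)=\frac{\Gamma(\gamma)}{\Gamma(\beta)\Gamma(\beta')\Gamma(\gamma-\beta-\beta')}\int_{s,t\ge0,\,s+t\le1}s^{\beta-1}t^{\beta'-1}(1-s-t)^{\gamma-\beta-\beta'-1}(1-xs-yt)^{-\alpha}ds\,dt.$$ *)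

(* Defs.v *)
From mathcomp Require Import all_boot all_order all_algebra.
From mathcomp Require Import all_classical all_reals all_analysis.
Import Order.TTheory GRing.Theory Num.Theory.
Import numFieldNormedType.Exports.

Set Implicit Arguments.
Unset Strict Implicit.
Unset Printing Implicit Defensive.

Local Open Scope classical_set_scope.
Local Open Scope ring_scope.

(* Euler's integral; meaningful for 0 < x. *)
Definition Gamma {R : realType} (x : R) : R :=
  \int[@lebesgue_measure R]_(t in `]0, +oo[) (t `^ (x - 1) * expR (- t)).

(* The rising factorial (x)_n = x (x + 1) ... (x + n - 1). *)
Definition pochhammer {R : realType} (x : R) (n : nat) : R :=
  \prod_(i < n) (x + i%:R).

(* Appell's double series, summed first over q and then over p; it converges
   absolutely for |x|, |y| < 1, so the order of summation is immaterial. *)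
Definition appellF1_series {R : realType} (al be be' ga x y : R) : R :=
  limn (series (fun p : nat => limn (series (fun q : nat =>
    pochhammer al (p + q)%N * pochhammer be p * pochhammer be' q
    / (p`!%:R * q`!%:R * pochhammer ga (p + q)%N) * x ^+ p * y ^+ q)))).

Definition triangle {R : realType} : set (R * R) :=
  [set z | [/\ 0 <= z.1, 0 <= z.2 & z.1 + z.2 <= 1]].

(* Meaningful for 0 < be, be', ga - be - be' and x, y < 1; the base
   1 - x s - y t is then positive on the triangle, and the values of the powers
   at base 0 only matter on the boundary, a null set. *)
Definition appellF1_integral {R : realType} (al be be' ga x y : R) : R :=
  Gamma ga / (Gamma be * Gamma be' * Gamma (ga - be - be')) *
  \int[(@lebesgue_measure R \x @lebesgue_measure R)%E]_(z in triangle)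
    (z.1 `^ (be - 1) * z.2 `^ (be' - 1)
     * (1 - z.1 - z.2) `^ (ga - be - be' - 1)
     * (1 - x * z.1 - y * z.2) `^ (- al)).

Definition appellF1 {R : realType} (al be be' ga x y : R) : R :=
  if (`|x| < 1) && (`|y| < 1) then appellF1_series al be be' ga x y
  else appellF1_integral al be be' ga x y.

Definition dtilde (R : realType) (a b c m : nat) : R :=
  a%:R + b%:R + c%:R + m%:R / 2 - 2.

Definition Htilde {R : realType} (a b c : nat) (u v : R) (m : nat) : R :=
  Gamma (dtilde R a b c m) / Gamma (a%:R + b%:R + c%:R) *
  appellF1 (dtilde R a b c m) c%:R b%:R (a%:R + b%:R + c%:R) u v.

(* Main.v *)
Require Import Defs.
From mathcomp Require Import all_boot all_order all_algebra.
From mathcomp Require Import all_classical all_reals all_analysis.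
From mathcomp Require Import measurable_realfun ring lra.
Import Order.TTheory GRing.Theory Num.Theory.
Import numFieldNormedType.Exports.

Local Open Scope classical_set_scope.
Local Open Scope ring_scope.

(** All four relations are read off from the integrals
      J_(i,j,k)(al; x, y)
        = int_T s^i t^j (1 - s - t)^k (1 - x s - y t)^(- al) ds dt
    over the triangle T ([euler_integral]), because
      Htilde_(a,b,c)(u, v; m)
        = Gamma(d) / ((a-1)! (b-1)! (c-1)!) J_(c-1,b-1,a-1)(d; u, v)
    with d = dtilde, whichever of its two formulas defines F_1 at (u, v)
    ([HtildeE]).  Differentiating under the integral sign in x brings down the
    factor al s and raises al by one, so d J_(i,j,k)(al) / dx is
    al J_(i+1,j,k)(al + 1), and likewise in y ([is_derive_euler_x],
    [is_derive_euler_y]).  As Gamma (d + 1) = d Gamma d ([GammaS]), this is the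
    rule for c + 1, and for b + 1.  The rule for m + 2 follows from integrating
      1 = (1 - x s - y t) + x s + y t
    against the integrand of J(al + 1) ([euler_integral_contiguous]).  In the
    quotient rule the values of F_1 are on both sides, so only the ratios of
    Gamma values have to be compared; that the denominators do not vanish is
    the positivity of J ([euler_integral_gt0]).

    The substance is that Appell's series and Euler's integral agree on the
    square |x|, |y| < 1 ([appellF1_seriesE]): without it the function to be
    differentiated would not even be known to be continuous where the
    definition of F_1 passes from one formula to the other.  For fixed p the sum
    over q of the series integrates a binomial series in y t; the sum over p of
    the results integrates a binomial series in x s / (1 - y t), and
      (1 - y t) (1 - x s / (1 - y t)) = 1 - x s - y t.
    Both exchanges of sum and integral are instances of bounded convergence,
    since a partial sum of the binomial series of (1 - z)^(- al) is at most
    (1 - |z|)^(- al) in absolute value ([normr_binomial_sum_le]).  What is left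
    is Dirichlet's evaluation of the moments int_T s^i t^j (1 - s - t)^k
    ([dirichlet_triangle]), which yields the factorials in the coefficients. *)

Local Notation lebesgue2 R := (@lebesgue_measure R \x @lebesgue_measure R)%E.

(** * Integrability of real-valued combinations *)

(** This lemma and the next two restate closure properties of integrable
    functions with the embedding of R outside the real expression, the form
    that the lemmas on real-valued integrals expect. *)
Lemma integrable_EFinZl {d} {T : measurableType d} {R : realType}
    {mu : {measure set T -> \bar R}} {D : set T} (r : R) (f : T -> R) :
  measurable D -> mu.-integrable D (EFin \o f) ->
  mu.-integrable D (EFin \o (fun x => r * f x)).
Proof. by move=> mD intf; have := integrableZl mD r intf; apply. Qed.

Lemma integrable_EFinD {d} {T : measurableType d} {R : realType}
    {mu : {measure set T -> \bar R}} {D : set T} (f g : T -> R) :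
  measurable D -> mu.-integrable D (EFin \o f) -> mu.-integrable D (EFin \o g) ->
  mu.-integrable D (EFin \o (fun x => f x + g x)).
Proof. by move=> mD intf intg; have := integrableD mD intf intg; apply. Qed.

Lemma integrable_EFinB {d} {T : measurableType d} {R : realType}
    {mu : {measure set T -> \bar R}} {D : set T} (f g : T -> R) :
  measurable D -> mu.-integrable D (EFin \o f) -> mu.-integrable D (EFin \o g) ->
  mu.-integrable D (EFin \o (fun x => f x - g x)).
Proof. by move=> mD intf intg; have := integrableB mD intf intg; apply. Qed.

(** * Euler's Gamma integral *)

Lemma powR_cvg_right0 {R : realType} (r : R) : 0 <= r ->
  t `^ r @[t --> 0^'+] --> 0 `^ r.
Proof.
rewrite le_eqVlt => /predU1P[<-|r0]; last first.
  by rewrite powR0 ?gt_eqF//; exact: powR_cvg0.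
under eq_fun do rewrite powRr0.
by rewrite powRr0; exact: cvg_cst.
Qed.

Lemma continuous_powR {R : realType} (r t : R) : 0 < t ->
  {for t, continuous (fun s : R => s `^ r)}.
Proof.
move=> t0; apply: differentiable_continuous; apply/derivable1_diffP.
by apply: derivable_powR; rewrite in_itv/= t0.
Qed.

(** The linear bound x <= exp x, raised to the power r at x = t / (2 r). *)
Lemma powR_le_expR {R : realType} (r t : R) : 0 <= r -> 0 <= t ->
  t `^ r <= (2 * r) `^ r * expR (2^-1 * t).
Proof.
rewrite le_eqVlt => /predU1P[<- t0|r0 t0].
  by rewrite !powRr0 mul1r (le_trans _ (expR_ge1Dx _))// lerDl mulr_ge0.
have r20 : 0 < 2 * r by rewrite mulr_gt0.
have tr0 : 0 <= t / (2 * r) by rewrite divr_ge0// ltW.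
rewrite [in leLHS](_ : t = (2 * r) * (t / (2 * r))); last first.
  by rewrite mulrC divfK// gt_eqF.
rewrite powRM// ?(ltW r20)// ler_wpM2l ?powR_ge0//.
have -> : expR (2^-1 * t) = expR (t / (2 * r)) `^ r.
  by rewrite -expRM; congr expR; field; rewrite gt_eqF.
apply: ge0_ler_powR; rewrite ?nnegrE ?expR_ge0 ?(ltW r0)//.
by rewrite (le_trans _ (expR_ge1Dx _))// lerDr.
Qed.

(** The integrand of Gamma is dominated by an exponential that is itself
    explicitly integrable. *)
Lemma powRMexpRN_le {R : realType} (r t : R) : 0 <= r -> 0 <= t ->
  t `^ r * expR (- t) <= (2 * r) `^ r * expR (- (2^-1 * t)).
Proof.
move=> r0 t0; rewrite (_ : - (2^-1 * t) = 2^-1 * t - t); last by field.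
by rewrite expRD mulrA ler_wpM2r ?expR_ge0// powR_le_expR.
Qed.

Lemma cvg_expRNM {R : realType} (k : R) : 0 < k ->
  expR (- (k * t)) @[t --> +oo] --> (0 : R).
Proof.
move=> k0; apply: (@cvg_comp _ _ _ (fun t : R => k * t) (fun t => expR (- t))
  _ (+oo : set_system R)); last exact: cvgr_expR.
by apply: gt0_cvgMry => //; exact: cvg_id.
Qed.

Lemma is_derive_expRNM {R : realType} (k t : R) :
  is_derive t 1 (fun t => expR (- (k * t))) (- k * expR (- (k * t))).
Proof.
have h : is_derive t 1 (fun t : R => - (k * t)) (- k).
  by apply: is_deriveN; apply: is_derive_eq; rewrite /GRing.scale/= mulr1.
apply: (is_derive_eq (@is_derive1_comp _ expR (fun t => - (k * t)) _ _ _ _ h)).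
by rewrite /GRing.scale/= mulrC.
Qed.

Lemma continuous_expRNM {R : realType} (k t : R) :
  {for t, continuous (fun t : R => expR (- (k * t)))}.
Proof.
apply: differentiable_continuous; apply/derivable1_diffP.
by have [] := is_derive_expRNM k t.
Qed.

Lemma integral_expRNM {R : realType} (k : R) : 0 < k ->
  (\int[@lebesgue_measure R]_(t in `[0%R, +oo[) (expR (- (k * t)))%:E
   = (k^-1)%:E)%E.
Proof.
move=> k0.
rewrite (@ge0_continuous_FTC2y _ _ (fun t => - k^-1 * expR (- (k * t))) 0 0).
- by rewrite mulr0 oppr0 expR0 mulr1 sub0e EFinN oppeK.
- by move=> x _; exact: expR_ge0.
- by apply: continuous_subspaceT => x; exact: continuous_expRNM.
- rewrite -[X in _ --> X](mulr0 (- k^-1)).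
  by apply: cvgM; [exact: cvg_cst|exact: cvg_expRNM].
- by move=> x _; apply: derivableM => //; have [] := is_derive_expRNM k x.
- apply: cvg_at_right_filter; apply: cvgM; first exact: cvg_cst.
  exact: continuous_expRNM.
- move=> x _; rewrite derive1E.
  have h := is_derive_expRNM k x.
  have [_ ->] : is_derive x 1 (fun t : R => - k^-1 * expR (- (k * t)))
      (expR (- (k * x))).
    by apply: is_derive_eq; rewrite /GRing.scale/=; field; rewrite gt_eqF.
  by [].
Qed.

Lemma integrable_expRNM {R : realType} (k : R) : 0 < k ->
  (@lebesgue_measure R).-integrable `[0, +oo[
    (EFin \o (fun t => expR (- (k * t)))).
Proof.
move=> k0; apply/integrableP; split.
  apply/measurable_EFinP; apply: measurable_funTS.
  apply: continuous_measurable_fun => t; exact: continuous_expRNM.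
under eq_integral do rewrite gee0_abs ?lee_fin ?expR_ge0//.
by rewrite integral_expRNM// ltry.
Qed.

Lemma measurable_powRMexpRN {R : realType} (r : R) (D : set R) :
  measurable_fun D (fun t : R => t `^ r * expR (- t)).
Proof.
apply: measurable_funTS; apply: measurable_funM; first exact: measurable_powR.
by apply: measurableT_comp => //; exact: measurable_funN.
Qed.

Lemma integrable_powRMexpRN {R : realType} (r : R) : 0 <= r ->
  (@lebesgue_measure R).-integrable `[0, +oo[
    (EFin \o (fun t => t `^ r * expR (- t))).
Proof.
move=> r0.
have k0 : 0 < 2^-1 :> R by [].
have hI : (@lebesgue_measure R).-integrable `[0, +oo[
    (fun t => ((2 * r) `^ r)%:E * (EFin \o (fun t => expR (- (2^-1 * t)))) t)%E.
  by apply: integrableZl => //; exact: integrable_expRNM.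
apply: le_integrable hI => //.
- by apply/measurable_EFinP; exact: measurable_powRMexpRN.
move=> t /=; rewrite in_itv/= andbT => t0.
rewrite lee_fin !ger0_norm ?mulr_ge0 ?powR_ge0 ?expR_ge0//.
exact: powRMexpRN_le.
Qed.

Lemma GammaE {R : realType} (x : R) : Gamma x =
  \int[@lebesgue_measure R]_(t in `[0, +oo[) (t `^ (x - 1) * expR (- t)).
Proof.
rewrite /Gamma /Rintegral integral_itv_obnd_cbnd//.
by apply/measurable_EFinP; exact: measurable_powRMexpRN.
Qed.

Lemma Gamma1 {R : realType} : Gamma (1 : R) = 1.
Proof.
rewrite GammaE /Rintegral.
have -> : (fun t : R => (t `^ (1 - 1) * expR (- t))%:E) =
    (fun t => (expR (- (1 * t)))%:E).
  by apply/funext => t; rewrite subrr powRr0 !mul1r.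
by rewrite integral_expRNM// invr1.
Qed.

Lemma Gamma_gt0 {R : realType} (x : R) : 1 <= x -> 0 < Gamma x.
Proof.
move=> x1; rewrite GammaE.
have i0 := @integrable_powRMexpRN R (x - 1) ltac:(by rewrite subr_ge0).
(* On [1, 2] the integrand is at least exp (- 2). *)
apply: (@lt_le_trans _ _ (expR (- 2))); first exact: expR_gt0.
rewrite -lee_fin /Rintegral fineK ?integrable_fin_num//.
apply: (@le_trans _ _ (\int[@lebesgue_measure R]_(t in `[1%R, 2%R])
   (t `^ (x - 1) * expR (- t))%:E)%E); last first.
  apply: ge0_subset_integral => //.
  - by apply/measurable_EFinP; exact: measurable_powRMexpRN.
  - by move=> t _; rewrite lee_fin mulr_ge0 ?powR_ge0 ?expR_ge0.
  - by apply: subset_itv; rewrite ?bnd_simp.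
apply: (@le_trans _ _ (\int[@lebesgue_measure R]_(t in `[1%R, 2%R])
   (expR (- 2))%:E)%E).
  rewrite integral_cst//= lebesgue_measure_itv/= lte_fin ltr1n -EFinB.
  by rewrite -EFinM lee_fin (_ : 2 - 1 = 1) ?mulr1//; ring.
apply: (@ge0_le_integral _ _ _ (@lebesgue_measure R)) => //.
- by apply/measurable_EFinP; exact: measurable_powRMexpRN.
move=> t /=; rewrite in_itv/= => /andP[t1 t2].
rewrite lee_fin -[leLHS]mul1r ler_pM ?expR_ge0// ?ler_expR ?lerN2//.
by rewrite -[leLHS](powRr0 t) ler_powR// subr_ge0.
Qed.

(** The function t^x exp (- t) vanishes at both ends of the half-line, so its
    derivative integrates to 0, which is the functional equation.  That
    derivative changes sign, whereas the fundamental theorem of calculus on a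
    half-line is about nonnegative integrands: a multiple of exp (- t / 2) large
    enough to make it nonnegative is added, and its integral subtracted. *)
Lemma GammaS {R : realType} (x : R) : 1 <= x -> Gamma (x + 1) = x * Gamma x.
Proof.
move=> x1; rewrite !GammaE addrK.
have x0 : 0 < x by exact: lt_le_trans x1.
(* M is the constant for which t^x exp (- t) <= M exp (- t / 2). *)
pose M := (2 * x) `^ x.
pose g r t : R := t `^ r * expR (- t).
pose F t := g x t - (2 * M) * expR (- (2^-1 * t)).
pose f t := x * g (x - 1) t - g x t + M * expR (- (2^-1 * t)).
have g0 (r : R) (r0 : 0 <= r) : g r t @[t --> 0^'+] --> g r 0.
  apply: cvgM; first exact: powR_cvg_right0.
  apply: cvg_at_right_filter; apply: continuous_comp; last exact: continuous_expR.
  exact: opp_continuous.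
have gc (r t : R) : 0 < t -> {for t, continuous (g r)}.
  move=> t0; rewrite /continuous_at; apply: cvgM; first exact: continuous_powR.
  by apply: continuous_comp; [exact: opp_continuous|exact: continuous_expR].
have dF (t : R) : 0 < t -> is_derive t 1 F (f t).
  move=> t0; have h1 := is_derive_expRNM 2^-1 t.
  have h2 := is_derive_expRNM 1 t.
  have h3 := is_derive1_powR x t0.
  have -> : F = (fun t : R => t `^ x * expR (- (1 * t)) - (2 * M) * expR (- (2^-1 * t))).
    by apply/funext => s; rewrite /F /g mul1r.
  by apply: is_derive_eq; rewrite /GRing.scale/= /f /g mul1r; field.
have Ff : \int[@lebesgue_measure R]_(t in `[0, +oo[) f t = 0 - F 0.
  apply: Rintegral_ge0_continuous_FTC2y.
  - move=> t t0; rewrite /f -addrA addr_ge0//.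
      by rewrite mulr_ge0 ?mulr_ge0 ?powR_ge0 ?expR_ge0// ltW.
    by rewrite addrC subr_ge0; apply: powRMexpRN_le => //; exact: ltW.
  - apply/continuous_within_itvcyP; split.
      move=> t; rewrite in_itv/= andbT => t0.
      apply: cvgD; first apply: cvgB.
      + by apply: cvgM; [exact: cvg_cst|exact: gc].
      + exact: gc.
      + by apply: cvgM; [exact: cvg_cst|exact: continuous_expRNM].
    apply: cvgD; first apply: cvgB.
    + by apply: cvgM; [exact: cvg_cst|apply: g0; rewrite subr_ge0].
    + by apply: g0; exact: ltW.
    + apply: cvgM; [exact: cvg_cst|apply: cvg_at_right_filter].
      exact: continuous_expRNM.
  - rewrite -[X in _ --> X](subr0 0); apply: cvgB.
      apply: (@squeeze_cvgr _ _ _ _ (cst 0) (fun t => M * expR (- (2^-1 * t)))).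
      + near=> t; have t0 : 0 <= t by near: t; exact: nbhs_pinfty_ge.
        rewrite mulr_ge0 ?powR_ge0 ?expR_ge0//=.
        by apply: powRMexpRN_le => //; exact: ltW.
      + exact: cvg_cst.
      + rewrite -[X in _ --> X](mulr0 M).
        by apply: cvgM; [exact: cvg_cst|exact: cvg_expRNM].
    rewrite -[X in _ --> X](mulr0 (2 * M)).
    by apply: cvgM; [exact: cvg_cst|exact: cvg_expRNM].
  - by move=> t /dF[].
  - apply: cvgB; first by apply: g0; exact: ltW.
    apply: cvgM; [exact: cvg_cst|apply: cvg_at_right_filter].
    exact: continuous_expRNM.
  - by move=> t; rewrite in_itv/= andbT derive1E => /dF[_ ->].
have ig (r : R) (r0 : 0 <= r) : (@lebesgue_measure R).-integrable `[0, +oo[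
    (EFin \o g r).
  exact: integrable_powRMexpRN.
have i1 : (@lebesgue_measure R).-integrable `[0, +oo[
    (EFin \o (fun t => x * g (x - 1) t)).
  by apply: integrable_EFinZl => //; apply: ig; rewrite subr_ge0.
have i2 := ig x (ltW x0).
have i3 := @integrable_expRNM R 2^-1 ltac:(by []).
have i4 : (@lebesgue_measure R).-integrable `[0, +oo[
    (EFin \o (fun t => M * expR (- (2^-1 * t)))).
  exact: integrable_EFinZl.
have i5 : (@lebesgue_measure R).-integrable `[0, +oo[
    (EFin \o (fun t => x * g (x - 1) t - g x t)).
  exact: integrable_EFinB.
move: Ff; rewrite /f RintegralD// RintegralB// !RintegralZl//; last first.
  by apply: ig; rewrite subr_ge0.
rewrite [X in _ + M * X](_ : _ = 2); last first.
  by rewrite /Rintegral integral_expRNM// invrK.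
rewrite /F /g powR0 ?gt_eqF// mul0r mulr0 oppr0 expR0.
lra.
Unshelve. all: by end_near. Qed.

Lemma Gamma_nat {R : realType} (n : nat) : Gamma (n.+1%:R : R) = n`!%:R.
Proof.
elim: n => [|n IH]; first by rewrite Gamma1 fact0.
by rewrite -natr1 GammaS ?ler1n// IH factS natrM.
Qed.

(** * Rising factorials *)

Lemma pochhammer0 {R : realType} (x : R) : pochhammer x 0 = 1.
Proof. by rewrite /pochhammer big_ord0. Qed.

Lemma pochhammerS {R : realType} (x : R) n :
  pochhammer x n.+1 = pochhammer x n * (x + n%:R).
Proof. by rewrite /pochhammer big_ord_recr. Qed.

Lemma pochhammerD {R : realType} (x : R) p q :
  pochhammer x (p + q) = pochhammer x p * pochhammer (x + p%:R) q.
Proof.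
elim: q => [|q IH]; first by rewrite addn0 pochhammer0 mulr1.
by rewrite addnS !pochhammerS IH natrD -mulrA addrA.
Qed.

Lemma pochhammerSl {R : realType} (x : R) n :
  pochhammer x n.+1 = x * pochhammer (x + 1) n.
Proof. by rewrite -add1n pochhammerD pochhammerS pochhammer0 mul1r addr0. Qed.

Lemma pochhammer_gt0 {R : realType} (x : R) n : 0 < x -> 0 < pochhammer x n.
Proof. by move=> x0; apply: prodr_gt0 => i _; rewrite ltr_wpDr. Qed.

Lemma pochhammer_nat {R : realType} (n k : nat) :
  pochhammer (n.+1%:R : R) k = (n + k)`!%:R / n`!%:R.
Proof.
elim: k => [|k IH]; first by rewrite pochhammer0 addn0 divff// pnatr_eq0 -lt0n fact_gt0.
by rewrite pochhammerS IH addnS factS natrM -natrD addSn -[RHS]mulrA mulrC.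
Qed.

(** * The binomial series *)

(** The mean value theorem between 0 and a point of either sign. *)
Lemma mean_value0 {R : realType} (f df : R -> R) (z : R) :
  (forall x : R, `|x| <= `|z| -> is_derive x 1 f (df x)) ->
  exists2 x, `|x| <= `|z| & f z - f 0 = df x * z.
Proof.
move=> fdf; have [z0|z0|<-] := ltgtP 0 z.
- have dx (x : R) : x \in `]0, z[ -> is_derive x 1 f (df x).
    rewrite in_itv/= => /andP[x0 xz]; apply: fdf.
    by rewrite !gtr0_norm// ltW.
  have [|x] := MVT z0 dx.
    apply: derivable_within_continuous => x; rewrite in_itv/= => /andP[x0 xz].
    by have [] : is_derive x 1 f (df x) by apply: fdf; rewrite ger0_norm// gtr0_norm.
  rewrite in_itv/= => /andP[x0 xz] E; exists x.
    by rewrite !gtr0_norm// ltW.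
  by rewrite E subr0.
- have dx (x : R) : x \in `]z, 0[ -> is_derive x 1 f (df x).
    rewrite in_itv/= => /andP[zx x0]; apply: fdf.
    by rewrite !ltr0_norm// lerN2 ltW.
  have [|x] := MVT z0 dx.
    apply: derivable_within_continuous => x; rewrite in_itv/= => /andP[zx x0].
    by have [] : is_derive x 1 f (df x) by apply: fdf; rewrite ler0_norm// ltr0_norm// lerN2.
  rewrite in_itv/= => /andP[zx x0] E; exists x.
    by rewrite !ltr0_norm// lerN2 ltW.
  by rewrite -opprB E sub0r mulrN opprK.
- by exists 0; rewrite ?subrr ?mulr0.
Qed.

(** The terms of the expansion of (1 - z)^(- al) in powers of z. *)
Definition binomial_term {R : realType} (al z : R) (n : nat) : R :=
  pochhammer al n / n`!%:R * z ^+ n.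

Lemma binomial_coefS {R : realType} (al : R) n :
  n.+1%:R * (pochhammer al n.+1 / n.+1`!%:R)
  = (al + n%:R) * (pochhammer al n / n`!%:R).
Proof.
rewrite pochhammerS factS natrM; field.
by rewrite nat1r !pnatr_eq0 -lt0n fact_gt0.
Qed.

Lemma is_derive_binomial_sum {R : realType} (al z : R) N :
  is_derive z 1 (fun z => series (binomial_term al z) N)
    (\sum_(0 <= n < N) pochhammer al n / n`!%:R * (n%:R * z ^+ n.-1)).
Proof.
rewrite /series/=; elim: N => [|N IH].
  under eq_fun do rewrite big_nil.
  by rewrite big_nil; exact: is_derive_cst.
under eq_fun do rewrite big_nat_recr//=.
rewrite big_nat_recr//=; apply: is_deriveD; rewrite /binomial_term.
have -> : (fun x : R => pochhammer al N / N`!%:R * x ^+ N) =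
    (pochhammer al N / N`!%:R) *: ((id : R -> R) ^+ N).
  by apply/funext => x; rewrite !fctE.
by apply: is_derive_eq; rewrite /GRing.scale/= mulr1.
Qed.

(** The function F = (1 - z)^(- al) solves (1 - z) F' = al F; a partial sum
    solves the same equation up to one monomial, because consecutive
    coefficients are related by [binomial_coefS] and the sum telescopes. *)
Lemma binomial_sum_ode {R : realType} (al z : R) N :
  (1 - z) * (\sum_(0 <= n < N.+1) pochhammer al n / n`!%:R * (n%:R * z ^+ n.-1))
  = al * series (binomial_term al z) N.+1
    - N.+1%:R * (pochhammer al N.+1 / N.+1`!%:R) * z ^+ N.
Proof.
rewrite /series/=; elim: N => [|N IH].
  rewrite !big_nat1 binomial_coefS /binomial_term pochhammer0 fact0 expr0 invr1.
  by ring.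
rewrite big_nat_recr//= [X in _ = al * X - _]big_nat_recr//= 2!mulrDr IH.
rewrite (binomial_coefS al N.+1) /binomial_term exprS.
set c := pochhammer al N.+1 / _.
by rewrite -(natr1 N); ring.
Qed.

(** Multiplied by (1 - z)^al, a partial sum should be close to 1.  By
    [binomial_sum_ode] the derivative of the product has a single term, which
    controls it in both ways needed below: its sign bounds the partial sums and
    its size gives their limit. *)
Lemma is_derive_binomial_remainder {R : realType} (al z : R) N : 0 < al -> z < 1 ->
  is_derive z 1 (fun z => series (binomial_term al z) N.+1 * (1 - z) `^ al)
    (- (N.+1%:R * (pochhammer al N.+1 / N.+1`!%:R)) * z ^+ N
     * (1 - z) `^ (al - 1)).
Proof.
move=> al0 z1; have z0 : 0 < 1 - z by rewrite subr_gt0.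
have h1 := is_derive_binomial_sum al z N.+1.
have h2 : is_derive z 1 (fun z : R => 1 - z) (- 1).
  by apply: is_derive_eq; rewrite add0r mul1r.
have h3 := @is_derive1_comp _ (fun x => x `^ al) (fun z => 1 - z) _ _ _
  (is_derive1_powR al z0) h2.
apply: (is_derive_eq (is_deriveM h1 h3)).
rewrite /GRing.scale/=.
have -> : (1 - z) `^ al = (1 - z) * (1 - z) `^ (al - 1).
  by rewrite mulr_powRB1// ltW.
have := binomial_sum_ode al z N.
set S := \sum_(_ <= _ < _) _; set T := series _ _.
set P := (1 - z) `^ _; set c := _ * z ^+ N => h.
have -> : (1 - z) * P * S = P * ((1 - z) * S) by ring.
by rewrite h /c; ring.
Qed.

Lemma nondecreasing_binomial_sum {R : realType} (al z : R) : 0 < al -> 0 <= z ->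
  nondecreasing_seq (series (binomial_term al z)).
Proof.
move=> al0 z0; apply/nondecreasing_seqP => n.
rewrite /series/= big_nat_recr//= lerDl /binomial_term.
by rewrite !mulr_ge0 ?exprn_ge0 ?invr_ge0// ltW// pochhammer_gt0.
Qed.

Lemma binomial_remainder0 {R : realType} (al : R) N :
  series (binomial_term al 0) N.+1 * (1 - 0) `^ al = 1.
Proof.
rewrite subr0 powR1 mulr1 /series/= big_nat_recl//= /binomial_term.
rewrite pochhammer0 fact0 expr0 divr1 mulr1 big1 ?addr0// => n _.
by rewrite expr0n/= mulr0.
Qed.

(** On [0, z] the function of [is_derive_binomial_remainder] decreases from
    1. *)
Lemma binomial_sum_le {R : realType} (al z : R) N : 0 < al -> 0 <= z -> z < 1 ->
  series (binomial_term al z) N <= (1 - z) `^ (- al).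
Proof.
move=> al0 z0 z1.
apply: (@le_trans _ _ (series (binomial_term al z) N.+1)).
  exact: nondecreasing_binomial_sum.
have p0 : 0 < (1 - z) `^ al by rewrite powR_gt0// subr_gt0.
rewrite powRN -[leRHS]mul1r ler_pdivlMr// -[leRHS](binomial_remainder0 al N).
pose g (z : R) := series (binomial_term al z) N.+1 * (1 - z) `^ al.
pose dg (z : R) := - (N.+1%:R * (pochhammer al N.+1 / N.+1`!%:R)) * z ^+ N
     * (1 - z) `^ (al - 1).
have gdg (x : R) : x < 1 -> is_derive x 1 g (dg x).
  by move=> x1; exact: is_derive_binomial_remainder.
suff : g z <= g 0 by [].
apply: (@ler0_derive1_le_cc _ g 0 z).
- move=> x; rewrite in_itv/= => /andP[_ xz].
  by have [] := gdg x (lt_trans xz z1).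
- move=> x; rewrite in_itv/= => /andP[x0 xz].
  rewrite derive1E; have [_ ->] := gdg x (lt_trans xz z1).
  rewrite /dg !mulNr oppr_le0 !mulr_ge0 ?powR_ge0 ?exprn_ge0 ?invr_ge0//.
    by rewrite ltW// pochhammer_gt0.
  exact: ltW.
- apply: derivable_within_continuous => x; rewrite in_itv/= => /andP[x0 xz].
  by have [] := gdg x (le_lt_trans xz z1).
- by rewrite in_itv/= lexx andbT.
- by rewrite in_itv/= lexx.
- by [].
Qed.

Lemma cvg_binomial_term0 {R : realType} (al r : R) : 0 < al -> 0 <= r -> r < 1 ->
  binomial_term al r n @[n --> \oo] --> 0.
Proof.
move=> al0 r0 r1; apply: cvg_series_cvg_0.
apply: nondecreasing_is_cvgn; first exact: nondecreasing_binomial_sum.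
exists ((1 - r) `^ (- al)) => _ [n _ <-]; exact: binomial_sum_le.
Qed.

(** By the mean value theorem the function of [is_derive_binomial_remainder]
    differs from 1 by at most a constant times N + 1 times the coefficient of
    index N + 1 times |z|^N.  This is al times the N-th term of the binomial
    series of exponent al + 1 at |z|, and tends to 0. *)
Lemma cvg_binomial_series {R : realType} (al z : R) : 0 < al -> `|z| < 1 ->
  series (binomial_term al z) @ \oo --> (1 - z) `^ (- al).
Proof.
move=> al0 z1.
have zlt1 : z < 1 by exact: le_lt_trans (ler_norm _) z1.
have p0 : 0 < (1 - z) `^ al by rewrite powR_gt0// subr_gt0.
(* For |x| <= |z| the base 1 - x lies between 1 - |z| and 2; which end gives
   the larger power depends on the sign of al - 1, and K covers both. *)
pose K := (1 - `|z|) `^ (al - 1) + 2 `^ (al - 1).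
have Kb (x : R) : `|x| <= `|z| -> (1 - x) `^ (al - 1) <= K.
  move=> xz; have xz1 : 1 - `|z| <= 1 - x.
    by rewrite lerD2l lerN2 (le_trans (ler_norm _)).
  have x2 : 1 - x <= 2.
    rewrite -[2]/(1 + 1)%R lerD2l (le_trans (ler_norm _))// normrN.
    by rewrite (le_trans xz)// ltW.
  have z0 : 0 < 1 - `|z| by rewrite subr_gt0.
  have [a1|a1] := leP 0 (al - 1).
    rewrite /K -[leLHS]add0r lerD ?powR_ge0// ge0_ler_powR// nnegrE ?ler0n//.
    by rewrite (le_trans _ xz1)// ltW.
  rewrite /K -[leLHS]addr0 lerD ?powR_ge0//.
  rewrite -[al - 1]opprK !(powRN _ (- (al - 1))).
  rewrite lef_pV2 ?posrE ?powR_gt0//; last exact: lt_le_trans xz1.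
  apply: ge0_ler_powR => //; rewrite ?nnegrE ?oppr_ge0 ltW//.
  exact: lt_le_trans xz1.
pose g N (z : R) := series (binomial_term al z) N.+1 * (1 - z) `^ al.
have gb N : `|g N z - 1| <= al * binomial_term (al + 1) `|z| N * K.
  pose dg (z : R) := - (N.+1%:R * (pochhammer al N.+1 / N.+1`!%:R)) * z ^+ N
     * (1 - z) `^ (al - 1).
  have [x xz|x xz] := @mean_value0 R (g N) dg z.
    apply: is_derive_binomial_remainder => //.
    by rewrite (le_lt_trans (ler_norm _))// (le_lt_trans xz).
  rewrite [g N 0]binomial_remainder0 => ->.
  have -> : al * binomial_term (al + 1) `|z| N =
      N.+1%:R * (pochhammer al N.+1 / N.+1`!%:R) * `|z| ^+ N.
    rewrite /binomial_term pochhammerSl factS natrM; field.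
    by rewrite nat1r !pnatr_eq0 -lt0n fact_gt0.
  rewrite /dg !mulNr normrN -mulrA normrM (normrM _ (x ^+ N)).
  set c := N.+1%:R * _.
  have c0 : 0 <= c by rewrite mulr_ge0// divr_ge0// ltW// pochhammer_gt0.
  rewrite (ger0_norm c0) normrX.
  rewrite ler_pM// ?(mulr_ge0 c0) ?exprn_ge0//.
    by rewrite ler_wpM2l// lerXn2r.
  rewrite normrM -[leRHS]mulr1 ler_pM// ?(ltW z1)//.
  by rewrite ger0_norm ?powR_ge0// Kb.
have g1 : g N z @[N --> \oo] --> (1 : R).
  apply/subr_cvg0; apply/norm_cvg0P.
  apply: (@squeeze_cvgr _ _ _ _ (cst 0)
    (fun N => al * binomial_term (al + 1) `|z| N * K)).
  - by apply: nearW => N; rewrite normr_ge0 gb.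
  - exact: cvg_cst.
  - rewrite -[X in _ --> X](mul0r K) -[X in X * K](mulr0 al).
    apply: cvgM; last exact: cvg_cst.
    apply: cvgM; first exact: cvg_cst.
    by apply: cvg_binomial_term0; rewrite ?addr_gt0.
have h : g N z * (1 - z) `^ (- al) @[N --> \oo] --> (1 - z) `^ (- al).
  by rewrite -[X in _ --> X]mul1r; apply: cvgM => //; exact: cvg_cst.
have E : (fun N => g N z * (1 - z) `^ (- al)) =
    (fun N => series (binomial_term al z) N.+1).
  by apply/funext => N; rewrite /g powRN mulfK// gt_eqF.
by rewrite -cvg_shiftS; rewrite E in h.
Qed.

(** * Dirichlet's integral over the triangle *)

Lemma is_derive_subXn {R : realType} (h t : R) k :
  is_derive t 1 (fun t => (h - t) ^+ k.+1) (- k.+1%:R * (h - t) ^+ k).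
Proof.
have h1 : is_derive t 1 (fun t : R => h - t) (- 1).
  by apply: is_derive_eq; rewrite add0r mul1r.
have -> : (fun t : R => (h - t) ^+ k.+1) = ((fun t => h - t) : R -> R) ^+ k.+1.
  by apply/funext => s; rewrite !fctE.
by apply: is_derive_eq; rewrite /GRing.scale/= mulrN1 mulNr.
Qed.

Lemma is_derive_Xn {R : realType} (t : R) k :
  is_derive t 1 (fun t => t ^+ k.+1) (k.+1%:R * t ^+ k).
Proof.
have -> : (fun t : R => t ^+ k.+1) = (id : R -> R) ^+ k.+1.
  by apply/funext => s; rewrite !fctE.
by apply: is_derive_eq; rewrite /GRing.scale/= mulr1.
Qed.

Lemma continuous_subXn {R : realType} (h : R) k :
  continuous (fun t : R => (h - t) ^+ k).
Proof.
move=> t; apply: (@continuous_comp _ _ _ (fun t : R => h - t) (fun t => t ^+ k)).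
  by apply: cvgB; [exact: cvg_cst|exact: cvg_id].
exact: exprn_continuous.
Qed.

Lemma integrable_XnsubXn {R : realType} (h : R) j k :
  (@lebesgue_measure R).-integrable `[0, h]
    (EFin \o (fun t => t ^+ j * (h - t) ^+ k)).
Proof.
apply: continuous_compact_integrable; first exact: segment_compact.
apply: continuous_subspaceT => t; apply: cvgM; first exact: exprn_continuous.
exact: continuous_subXn.
Qed.

(** Euler's beta integral on [0, h], by integration by parts: each step moves
    one unit of the exponent k to the exponent j. *)
Lemma integral_XnsubXn {R : realType} (h : R) j k : 0 <= h ->
  \int[@lebesgue_measure R]_(t in `[0, h]) (t ^+ j * (h - t) ^+ k)
  = (j`! * k`!)%:R / (j + k).+1`!%:R * h ^+ (j + k).+1.
Proof.
rewrite le_eqVlt => /predU1P[<-|h0].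
  by rewrite set_itv1 Rintegral_set1 expr0n/= mulr0.
elim: k j => [|k IH] j.
  have dX (t : R) := @is_derive_Xn R t j.
  have H : \int[@lebesgue_measure R]_(t in `[0, h]) (j.+1%:R * t ^+ j) = h ^+ j.+1.
    rewrite /Rintegral (@continuous_FTC2 _ _ (fun t : R => t ^+ j.+1) _ _ h0)//.
    - by rewrite -EFinB/= expr0n subr0.
    - apply: continuous_subspaceT => t; apply: cvgM; first exact: cvg_cst.
      exact: exprn_continuous.
    - split; first by move=> t _; have [] := dX t.
      + by apply: cvg_at_right_filter; exact: exprn_continuous.
      + by apply: cvg_at_left_filter; exact: exprn_continuous.
    - by move=> t _; rewrite derive1E; have [_ ->] := dX t.
  have int0 := integrable_XnsubXn h j 0.
  have E : (fun t : R => t ^+ j * (h - t) ^+ 0) = (fun t => t ^+ j).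
    by apply/funext => t; rewrite expr0 mulr1.
  rewrite E in int0 *.
  move: H; rewrite RintegralZl// addn0 fact0 muln1 factS natrM => <-.
  by field; rewrite nat1r !pnatr_eq0 -lt0n fact_gt0.
have dF (t : R) := @is_derive_subXn R h t k.
have dG (t : R) : is_derive t 1 (fun t : R => j.+1%:R^-1 * t ^+ j.+1) (t ^+ j).
  have := @is_derive_Xn R t j => hX; apply: is_derive_eq.
  by rewrite /GRing.scale/= mulrA mulVf ?mul1r// pnatr_eq0.
under eq_Rintegral do rewrite mulrC.
rewrite (@Rintegration_by_parts R (fun t => (h - t) ^+ k.+1)
  (fun t => j.+1%:R^-1 * t ^+ j.+1) (fun t => - k.+1%:R * (h - t) ^+ k)
  (fun t => t ^+ j) 0 h)//.
- rewrite subrr !expr0n/= mul0r !mulr0 !sub0r.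
  have -> : (fun x => - k.+1%:R * (h - x) ^+ k * (j.+1%:R^-1 * x ^+ j.+1)) =
     (fun x => (- k.+1%:R / j.+1%:R) * (x ^+ j.+1 * (h - x) ^+ k)).
    by apply/funext => x; ring.
  rewrite RintegralZl ?IH//; last exact: integrable_XnsubXn.
  rewrite addSnnS !factS !natrM; field.
  by rewrite !nat1r -natrD nat1r !pnatr_eq0 -lt0n fact_gt0.
- apply: continuous_subspaceT => t; apply: cvgM; first exact: cvg_cst.
  exact: continuous_subXn.
- split; first by move=> t _; have [] := dF t.
  + by apply: cvg_at_right_filter; exact: continuous_subXn.
  + by apply: cvg_at_left_filter; exact: continuous_subXn.
- by move=> t _; rewrite derive1E; have [_ ->] := dF t.
- by apply: continuous_subspaceT => t; exact: exprn_continuous.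
- split; first by move=> t _; have [] := dG t.
  + apply: cvg_at_right_filter; apply: cvgM; first exact: cvg_cst.
    exact: exprn_continuous.
  + apply: cvg_at_left_filter; apply: cvgM; first exact: cvg_cst.
    exact: exprn_continuous.
- by move=> t _; rewrite derive1E; have [_ ->] := dG t.
Qed.

Lemma measurable_triangle {R : realType} : measurable (@triangle R).
Proof.
have -> : @triangle R = (fst @^-1` `[0, +oo[) `&` (snd @^-1` `[0, +oo[)
    `&` ((fun z : R * R => z.1 + z.2) @^-1` `]-oo, 1]).
  by apply/seteqP; split=> -[s t]/=; rewrite !in_itv/= !andbT; [move=> [? ? ?]|move=> [[? ?] ?]].
apply: measurableI; first apply: measurableI.
- rewrite -[X in measurable X]setTI; apply: measurable_fst => //.
- rewrite -[X in measurable X]setTI; apply: measurable_snd => //.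
- rewrite -[X in measurable X]setTI; apply: measurable_funD => //.
Qed.

Lemma triangle_le1 {R : realType} (z : R * R) : triangle z ->
  [/\ 0 <= z.1 <= 1, 0 <= z.2 <= 1 & 0 <= 1 - z.1 - z.2 <= 1].
Proof. by move=> [? ? ?]; split; lra. Qed.

Lemma triangle_lty {R : realType} :
  ((@lebesgue_measure R \x @lebesgue_measure R) triangle < +oo)%E.
Proof.
have mI : measurable (`[0%R, 1%R] : set R) by [].
apply: (@le_lt_trans _ _ ((@lebesgue_measure R \x @lebesgue_measure R)%E
   (`[0%R, 1%R] `*` `[0%R, 1%R]))).
  apply: le_measure; rewrite ?inE.
  - exact: measurable_triangle.
  - exact: measurableX.
  by move=> z /triangle_le1[? ? ?]; split; rewrite /= in_itv.
rewrite product_measure1E//= lebesgue_measure_itv/= lte_fin ltr01 -EFinB.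
by rewrite -EFinM ltry.
Qed.

Definition triangle_weight {R : realType} (i j k : nat) (z : R * R) : R :=
  z.1 ^+ i * z.2 ^+ j * (1 - z.1 - z.2) ^+ k.

Lemma measurable_triangle_weight {R : realType} i j k (D : set (R * R)) :
  measurable_fun D (@triangle_weight R i j k).
Proof.
apply: measurable_funTS; apply: measurable_funM; first apply: measurable_funM.
- by apply: measurable_funX.
- by apply: measurable_funX.
- apply: measurable_funX; apply: measurable_funB => //.
  by apply: measurable_funB.
Qed.

Lemma triangle_weight_ge0 {R : realType} i j k (z : R * R) : triangle z ->
  0 <= triangle_weight i j k z.
Proof.
by move=> /triangle_le1[/andP[? _] /andP[? _] /andP[? _]];
  rewrite !mulr_ge0 ?exprn_ge0.
Qed.

Lemma triangle_weight_le1 {R : realType} i j k (z : R * R) : triangle z ->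
  triangle_weight i j k z <= 1.
Proof.
move=> /triangle_le1[/andP[? ?] /andP[? ?] /andP[? ?]].
by rewrite !mulr_ile1 ?mulr_ge0 ?exprn_ge0 ?exprn_ile1.
Qed.

(** The slice of the triangle at abscissa x is the segment [0, 1 - x], and it is
    empty unless x lies in [0, 1]. *)
Lemma integral_triangle_slice {R : realType} (i j k : nat) (x : R) :
  (\int[@lebesgue_measure R]_y ((triangle_weight i j k \_ triangle) (x, y))%:E
  = (((fun x : R => (j`! * k`!)%:R / (j + k).+1`!%:R *
       (x ^+ i * (1 - x) ^+ (j + k).+1)) \_ `[0, 1]) x)%:E)%E.
Proof.
rewrite [in RHS]patchE; case: ifPn => [/set_mem|/negP x01]; last first.
  rewrite integral0_eq// => y _; rewrite patchE ifF//; apply/negP => /set_mem.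
  move=> /triangle_le1[x01' _ _]; apply: x01; apply/mem_set.
  by rewrite /= in_itv.
rewrite /= in_itv/= => /andP[x0 x1].
have x1' : 0 <= 1 - x by rewrite subr_ge0.
pose g (y : R) := x ^+ i * (y ^+ j * (1 - x - y) ^+ k).
have ig : (@lebesgue_measure R).-integrable `[0, 1 - x] (EFin \o g).
  by apply: integrable_EFinZl => //; exact: integrable_XnsubXn.
transitivity (\int[@lebesgue_measure R]_(y in `[0%R, (1 - x)%R]) (g y)%:E)%E.
  rewrite [RHS]integral_mkcond; apply: eq_integral => y _.
  rewrite (restrict_EFin g)/= [in LHS]patchE [in RHS]patchE.
  have -> : ((x, y) \in triangle) = (y \in `[0, (1 - x)]%classic).
    apply/idP/idP => /set_mem; rewrite /triangle/= ?in_itv/=.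
      by move=> [_ ? ?]; apply/mem_set; rewrite /= in_itv/=; lra.
    by move=> ?; apply/mem_set; split => /=; lra.
  by case: ifPn => // _; rewrite /triangle_weight /g/= mulrA.
rewrite -[LHS]fineK ?integrable_fin_num//; congr EFin.
rewrite -/(Rintegral _ _ _) RintegralZl//; last exact: integrable_XnsubXn.
by rewrite integral_XnsubXn// mulrCA.
Qed.

(** Tonelli's theorem makes this a beta integral over the slices followed by a
    beta integral in the abscissa. *)
Lemma dirichlet_triangle {R : realType} (i j k : nat) :
  \int[lebesgue2 R]_(z in triangle)
    triangle_weight i j k z
  = (i`! * j`! * k`!)%:R / (i + j + k).+2`!%:R.
Proof.
rewrite Rintegral_mkcond /Rintegral fubini_tonelli1; last 2 first.
- apply/measurable_EFinP; apply/(measurable_restrictT _ measurable_triangle).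
  exact: measurable_triangle_weight.
- move=> z; rewrite lee_fin patchE; case: ifPn => // /set_mem.
  exact: triangle_weight_ge0.
rewrite /fubini_F/=.
under eq_integral do rewrite integral_triangle_slice.
rewrite -/(Rintegral _ _ _) -Rintegral_mkcond RintegralZl//; last first.
  exact: integrable_XnsubXn.
rewrite integral_XnsubXn// expr1n mulr1 addnS addnA.
have natM (m n : nat) : (m * n)%:R = m%:R * n%:R :> R by exact: natrM.
have fact_neq0 n : n`!%:R != 0 :> R by rewrite pnatr_eq0 -lt0n fact_gt0.
rewrite (natM j`!) (natM (i`! * j`!)%N) (natM i`!) (natM i`!).
move: (fact_neq0 (j + k).+1) (fact_neq0 (i + j + k).+2).
set p := (j + k).+1`!%:R; set q := (i + j + k).+2`!%:R => p0 q0.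
by field; rewrite p0 q0.
Qed.

(** * Exchanging a series with an integral *)

Lemma bounded_integrable {d} {T : measurableType d} {R : realType}
    {mu : {measure set T -> \bar R}} {D : set T} (f : T -> R) (C : R) :
  measurable D -> (mu D < +oo)%E -> measurable_fun D f ->
  (forall z, D z -> `|f z| <= C) -> mu.-integrable D (EFin \o f).
Proof.
move=> mD muD mf fC; apply: measurable_bounded_integrable => //.
exists C; split; first exact: num_real.
by move=> M CM z Dz; apply: le_trans (fC z Dz) _; exact: ltW.
Qed.

Lemma bounded_cvg_Rintegral {d} {T : measurableType d} {R : realType}
    {mu : {measure set T -> \bar R}} {D : set T} (f_ : nat -> T -> R)
    (f : T -> R) (C : R) :
  measurable D -> (mu D < +oo)%E -> (forall n, measurable_fun D (f_ n)) ->
  (forall n z, D z -> `|f_ n z| <= C) ->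
  (forall z, D z -> f_ n z @[n --> \oo] --> f z) ->
  \int[mu]_(z in D) f_ n z @[n --> \oo] --> \int[mu]_(z in D) f z.
Proof.
move=> mD muD mf_ f_C f_f.
have f_fE z : D z -> (f_ n z)%:E @[n --> \oo] --> (f z)%:E.
  by move=> Dz; apply: cvg_EFin; [exact: nearW|exact: f_f].
have mf : measurable_fun D (EFin \o f).
  apply: (emeasurable_fun_cvg (fun n => EFin \o f_ n)) => // n.
  exact/measurable_EFinP.
have C0 : mu.-integrable D (EFin \o cst C).
  by apply: (@bounded_integrable _ _ _ _ _ _ `|C|).
have [/integrable_fin_num ff _ cf] := @dominated_convergence _ _ _ mu D mD
  (fun n => EFin \o f_ n) (EFin \o f) (EFin \o cst C)
  (fun n => (measurable_EFinP _ _).2 (mf_ n)) mf (aeW _ f_fE) C0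
  (aeW _ (fun z n Dz => f_C n z Dz)).
by apply: fine_cvg; rewrite fineK//; apply: ff.
Qed.

Lemma Rintegral_series {d} {T : measurableType d} {R : realType}
    {mu : {measure set T -> \bar R}} {D : set T} (t_ : nat -> T -> R) N :
  measurable D -> (forall n, mu.-integrable D (EFin \o t_ n)) ->
  mu.-integrable D (EFin \o (fun z => series (t_ ^~ z) N)) /\
  \int[mu]_(z in D) series (t_ ^~ z) N =
    series (fun n => \int[mu]_(z in D) t_ n z) N.
Proof.
move=> mD it_; rewrite /series/=; elim: N => [|N [iN IH]].
  have -> : (fun z => \sum_(0 <= k < 0) t_ k z) = cst 0.
    by apply/funext => z; rewrite big_nil.
  rewrite big_nil; split; first exact: integrable0.
  by rewrite /Rintegral integral0.
have -> : (fun z => \sum_(0 <= k < N.+1) t_ k z) =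
    (fun z => \sum_(0 <= k < N) t_ k z + t_ N z).
  by apply/funext => z; rewrite big_nat_recr.
split; first exact: integrable_EFinD.
by rewrite RintegralD// IH big_nat_recr.
Qed.

(** Each term is bounded as a difference of two partial sums, so a bound on the
    partial sums is enough to integrate termwise. *)
Lemma cvg_series_Rintegral {d} {T : measurableType d} {R : realType}
    {mu : {measure set T -> \bar R}} {D : set T} (t_ : nat -> T -> R)
    (f : T -> R) (C : R) :
  measurable D -> (mu D < +oo)%E -> (forall n, measurable_fun D (t_ n)) ->
  (forall N z, D z -> `|series (t_ ^~ z) N| <= C) ->
  (forall z, D z -> series (t_ ^~ z) @ \oo --> f z) ->
  series (fun n => \int[mu]_(z in D) t_ n z) @ \oo --> \int[mu]_(z in D) f z.
Proof.
move=> mD muD mt sC sf.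
have it n : mu.-integrable D (EFin \o t_ n).
  apply: (@bounded_integrable _ _ _ _ _ _ (C + C)) => // z Dz.
  have -> : t_ n z = series (t_ ^~ z) n.+1 - series (t_ ^~ z) n.
    by rewrite /series/= big_nat_recr//= addrAC subrr add0r.
  by rewrite (le_trans (ler_normB _ _))// lerD// sC.
have -> : series (fun n => \int[mu]_(z in D) t_ n z) =
    (fun N => \int[mu]_(z in D) series (t_ ^~ z) N).
  by apply/funext => N; have [_ ->] := @Rintegral_series _ _ _ mu D t_ N mD it.
apply: (@bounded_cvg_Rintegral _ _ _ _ _ _ _ C) => // N.
by have [/integrableP[/measurable_EFinP]] := @Rintegral_series _ _ _ mu D t_ N mD it.
Qed.

(** The domination for both exchanges of sum and integral in Appell's series. *)
Lemma normr_binomial_sum_le {R : realType} (al z r : R) N : 0 < al ->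
  `|z| <= r -> r < 1 -> `|series (binomial_term al z) N| <= (1 - r) `^ (- al).
Proof.
move=> al0 zr r1; have r0 : 0 <= r by exact: le_trans zr.
apply: le_trans (binomial_sum_le al r N al0 r0 r1).
rewrite /series/= (le_trans (ler_norm_sum _ _ _))//.
apply: ler_sum => n _; rewrite /binomial_term normrM normrX.
have c0 : 0 <= pochhammer al n / n`!%:R by rewrite divr_ge0// ltW// pochhammer_gt0.
by rewrite (ger0_norm c0) ler_wpM2l// lerXn2r// nnegrE.
Qed.

Lemma powRN_le {R : realType} (d t al : R) : 0 <= al -> 0 < d -> d <= t ->
  t `^ (- al) <= d `^ (- al).
Proof.
move=> al0 d0 dt; have t0 := lt_le_trans d0 dt.
rewrite !powRN lef_pV2 ?posrE ?powR_gt0// ge0_ler_powR ?nnegrE//; exact: ltW.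
Qed.

(** * Appell's series is Euler's integral *)

(** Euler's integral for F_1(al; i + 1, j + 1; i + j + k + 3; x, y) without its
    normalising Gamma factors.  Natural exponents are used so that all the
    integrals which occur have bounded integrands and so that raising i or j
    multiplies the integrand by a coordinate. *)
Definition euler_integral {R : realType} (i j k : nat) (al x y : R) : R :=
  \int[lebesgue2 R]_(z in triangle)
    (triangle_weight i j k z * (1 - x * z.1 - y * z.2) `^ (- al)).

(** On the triangle x z.1 + y z.2 is at most r (z.1 + z.2), hence at most r. *)
Lemma triangle_base_ge {R : realType} (r x y : R) (z : R * R) :
  0 <= r -> x <= r -> y <= r -> triangle z ->
  1 - r <= 1 - x * z.1 - y * z.2.
Proof. by move=> r0 xr yr [z1 z2 z12]; nra. Qed.

Lemma max_lt1 {R : realType} (x y : R) : x < 1 -> y < 1 ->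
  exists r, [/\ 0 <= r, r < 1, x <= r & y <= r].
Proof.
move=> x1 y1; exists (Num.max 0 (Num.max x y)).
by rewrite !gt_max !le_max !lexx ltr01 x1 y1 !orbT.
Qed.

Lemma triangle_base_gt0 {R : realType} (x y : R) (z : R * R) :
  x < 1 -> y < 1 -> triangle z -> 0 < 1 - x * z.1 - y * z.2.
Proof.
move=> x1 y1 Tz; have [r [r0 r1 xr yr]] := max_lt1 x y x1 y1.
by apply: lt_le_trans (triangle_base_ge r x y z r0 xr yr Tz); rewrite subr_gt0.
Qed.

Lemma measurable_euler_integrand {R : realType} (i j k : nat) (al x y : R) D :
  measurable_fun D (fun z : R * R =>
    triangle_weight i j k z * (1 - x * z.1 - y * z.2) `^ (- al)).
Proof.
apply: measurable_funM; first exact: measurable_triangle_weight.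
apply: measurable_funTS.
apply: (@measurableT_comp _ _ _ _ _ _ (fun t : R => t `^ (- al))).
  exact: measurable_powR.
by apply: measurable_funB; [apply: measurable_funB|] => //; apply: measurable_funM.
Qed.

Lemma integrable_euler_integrand {R : realType} (i j k : nat) (al x y : R) :
  0 <= al -> x < 1 -> y < 1 ->
  (lebesgue2 R).-integrable triangle
    (EFin \o (fun z => triangle_weight i j k z
                       * (1 - x * z.1 - y * z.2) `^ (- al))).
Proof.
move=> al0 x1 y1; have [r [r0 r1 xr yr]] := max_lt1 x y x1 y1.
apply: (@bounded_integrable _ _ _ _ _ _ ((1 - r) `^ (- al))).
- exact: measurable_triangle.
- exact: triangle_lty.
- exact: measurable_euler_integrand.
move=> z Tz; rewrite ger0_norm; last first.
  by rewrite mulr_ge0 ?powR_ge0 ?triangle_weight_ge0.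
rewrite -[leRHS]mul1r ler_pM ?powR_ge0 ?triangle_weight_ge0 ?triangle_weight_le1//.
by apply: powRN_le => //; [rewrite subr_gt0|exact: triangle_base_ge].
Qed.

Lemma triangle_weightMX {R : realType} (i j k p q : nat) (z : R * R) :
  triangle_weight (i + p) (j + q) k z
  = triangle_weight i j k z * (z.1 ^+ p * z.2 ^+ q).
Proof. by rewrite /triangle_weight !exprD; ring. Qed.

(** The quotients of Pochhammer symbols of the parameters i + 1, j + 1 and
    i + j + k + 3 are a normalised Dirichlet integral; the remaining factors are
    grouped as a p-th term in x z.1 times the q-th term of a binomial series in
    y z.2 of exponent al + p. *)
Lemma appell_termE {R : realType} (i j k p q : nat) (al x y : R) :
  pochhammer al (p + q) * pochhammer i.+1%:R p * pochhammer j.+1%:R q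
    / (p`!%:R * q`!%:R * pochhammer (i + j + k).+3%:R (p + q)) * x ^+ p * y ^+ q
  = (i + j + k).+2`!%:R / (i`! * j`! * k`!)%:R
    * \int[lebesgue2 R]_(z in triangle)
       (triangle_weight i j k z * (pochhammer al p / p`!%:R * (x * z.1) ^+ p)
        * binomial_term (al + p%:R) (y * z.2) q).
Proof.
pose c := pochhammer al p / p`!%:R * x ^+ p
  * (pochhammer (al + p%:R) q / q`!%:R * y ^+ q).
have -> : (fun z : R * R => triangle_weight i j k z *
    (pochhammer al p / p`!%:R * (x * z.1) ^+ p)
    * binomial_term (al + p%:R) (y * z.2) q) =
  (fun z => c * triangle_weight (i + p) (j + q) k z).
  by apply/funext => z; rewrite triangle_weightMX /binomial_term !exprMn /c; ring.
rewrite RintegralZl ?dirichlet_triangle; last 2 first.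
- exact: measurable_triangle.
- apply: (@bounded_integrable _ _ _ _ _ _ 1).
  + exact: measurable_triangle.
  + exact: triangle_lty.
  + exact: measurable_triangle_weight.
  + by move=> z Tz; rewrite ger0_norm ?triangle_weight_ge0 ?triangle_weight_le1.
have natM (m n : nat) : (m * n)%:R = m%:R * n%:R :> R by exact: natrM.
have fact_neq0 n : n`!%:R != 0 :> R by rewrite pnatr_eq0 -lt0n fact_gt0.
rewrite pochhammerD !pochhammer_nat /c.
rewrite (natM (i`! * j`!)%N) (natM i`!) (natM ((i + p)`! * _)%N) (natM (i + p)`!).
have -> : (i + p + (j + q) + k).+2 = ((i + j + k).+2 + (p + q))%N.
  by rewrite addnACA addnAC !addSn.
field.
by rewrite !fact_neq0.
Qed.

(** For fixed p the sum over q expands (1 - y z.2)^(- (al + p)). *)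
Lemma cvg_appell_inner {R : realType} (i j k p : nat) (al x y : R) :
  0 < al -> `|x| < 1 -> `|y| < 1 ->
  series (fun q => \int[lebesgue2 R]_(z in triangle)
       (triangle_weight i j k z * (pochhammer al p / p`!%:R * (x * z.1) ^+ p)
        * binomial_term (al + p%:R) (y * z.2) q)) @ \oo -->
  \int[lebesgue2 R]_(z in triangle)
       (triangle_weight i j k z * (pochhammer al p / p`!%:R * (x * z.1) ^+ p)
        * (1 - y * z.2) `^ (- (al + p%:R))).
Proof.
move=> al0 x1 y1; have alp : 0 < al + p%:R by rewrite ltr_wpDr.
pose A : R := pochhammer al p / p`!%:R.
have A0 : 0 <= A by rewrite divr_ge0// ltW// pochhammer_gt0.
apply: (@cvg_series_Rintegral _ _ _ _ _ _ _ (A * (1 - `|y|) `^ (- (al + p%:R)))).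
- exact: measurable_triangle.
- exact: triangle_lty.
- move=> q; rewrite /binomial_term.
  apply: measurable_funM; first apply: measurable_funM.
  + exact: measurable_triangle_weight.
  + apply: measurable_funTS; apply: measurable_funM => //.
    by apply: measurable_funX; apply: measurable_funM.
  + apply: measurable_funTS; apply: measurable_funM => //.
    by apply: measurable_funX; apply: measurable_funM.
- move=> N z Tz; have [/andP[z10 z11] /andP[z20 z21] _] := triangle_le1 z Tz.
  rewrite /series/= -mulr_sumr normrM ler_pM ?normr_ge0//.
    rewrite normrM -[leRHS]mul1r ler_pM ?normr_ge0//.
      by rewrite ger0_norm ?triangle_weight_ge0 ?triangle_weight_le1.
    rewrite -/A normrM (ger0_norm A0) -[leRHS]mulr1 ler_wpM2l// normrX.
    rewrite exprn_ile1// normrM mulr_ile1 ?normr_ge0// ?(ltW x1)//.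
    by rewrite ger0_norm.
  apply: normr_binomial_sum_le => //.
  by rewrite normrM -[leRHS]mulr1 ler_wpM2l// ger0_norm.
- move=> z Tz; have [/andP[z10 z11] /andP[z20 z21] _] := triangle_le1 z Tz.
  have yz : `|y * z.2| < 1.
    by rewrite normrM (le_lt_trans _ y1)// -[leRHS]mulr1 ler_wpM2l// ger0_norm.
  have -> : series ((fun q z => triangle_weight i j k z *
      (pochhammer al p / p`!%:R * (x * z.1) ^+ p) *
      binomial_term (al + p%:R) (y * z.2) q) ^~ z) =
    (fun N => (triangle_weight i j k z * (pochhammer al p / p`!%:R * (x * z.1) ^+ p))
       * series (binomial_term (al + p%:R) (y * z.2)) N).
    by apply/funext => N; rewrite /series/= mulr_sumr.
  by apply: cvgM; [exact: cvg_cst|exact: cvg_binomial_series].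
Qed.

(** With the factor (1 - y z.2)^(- al) taken out, the sum over p is the binomial
    series in x z.1 / (1 - y z.2).  This quotient is at most |x| in absolute
    value, since z.1 <= 1 - z.2 <= 1 - y z.2. *)
Lemma cvg_appell_outer {R : realType} (i j k : nat) (al x y : R) :
  0 < al -> `|x| < 1 -> `|y| < 1 ->
  series (fun p => \int[lebesgue2 R]_(z in triangle)
       (triangle_weight i j k z * (pochhammer al p / p`!%:R * (x * z.1) ^+ p)
        * (1 - y * z.2) `^ (- (al + p%:R)))) @ \oo -->
  euler_integral i j k al x y.
Proof.
move=> al0 x1 y1; rewrite /euler_integral.
have b0 z : triangle z -> 0 < 1 - `|y| <= 1 - y * z.2.
  move=> /triangle_le1[_ /andP[z20 z21] _]; rewrite subr_gt0 y1 lerD2l lerN2.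
  by rewrite (le_trans (ler_norm _))// normrM -[leRHS]mulr1 ler_wpM2l// ger0_norm.
have q1 (z : R * R) : triangle z -> `|x * z.1 / (1 - y * z.2)| <= `|x|.
  move=> Tz; have [z1 z2 z12] := Tz; have /andP[y0 yz] := b0 z Tz.
  have b0' := lt_le_trans y0 yz.
  rewrite normrM normfV (gtr0_norm b0') ler_pdivrMr// normrM (ger0_norm z1).
  rewrite ler_wpM2l//; have : y * z.2 <= z.2.
    by rewrite -[leRHS]mul1r ler_wpM2r// (le_trans (ler_norm _))// ltW.
  lra.
have seriesE z : triangle z -> series ((fun p z => triangle_weight i j k z
      * (pochhammer al p / p`!%:R * (x * z.1) ^+ p)
      * (1 - y * z.2) `^ (- (al + p%:R))) ^~ z) =
    (fun N => (triangle_weight i j k z * (1 - y * z.2) `^ (- al))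
       * series (binomial_term al (x * z.1 / (1 - y * z.2))) N).
  move=> Tz; have /andP[y0 yz] := b0 z Tz; have b0' := lt_le_trans y0 yz.
  apply/funext => N; rewrite /series/= mulr_sumr; apply: eq_bigr => p _.
  rewrite opprD powRD; last by rewrite (gt_eqF b0') implybT.
  rewrite powR_invn ?(ltW b0')// /binomial_term !exprMn exprVn.
  by rewrite -!mulrA; congr (_ * _); ring.
apply: (@cvg_series_Rintegral _ _ _ _ _ _ _
   ((1 - `|y|) `^ (- al) * (1 - `|x|) `^ (- al))).
- exact: measurable_triangle.
- exact: triangle_lty.
- move=> q; rewrite /binomial_term.
  have my : measurable_fun [set: R * R] (fun z : R * R => 1 - y * z.2).
    by apply: measurable_funB => //; apply: measurable_funM.
  apply: measurable_funM; first apply: measurable_funM.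
  + exact: measurable_triangle_weight.
  + apply: measurable_funTS; apply: measurable_funM => //.
    by apply: measurable_funX; apply: measurable_funM.
  + apply: measurable_funTS.
    apply: (@measurableT_comp _ _ _ _ _ _ (fun t : R => t `^ (- (al + q%:R)))).
      exact: measurable_powR.
    by apply: measurable_funB => //; apply: measurable_funM.
- move=> N z Tz; have /andP[y0 yz] := b0 z Tz.
  rewrite seriesE// normrM ler_pM ?normr_ge0//.
    rewrite normrM -[leRHS]mul1r ler_pM ?normr_ge0//.
      by rewrite ger0_norm ?triangle_weight_ge0 ?triangle_weight_le1.
    by rewrite ger0_norm ?powR_ge0// powRN_le// ltW.
  by apply: normr_binomial_sum_le => //; exact: q1.
- move=> z Tz; have /andP[y0 yz] := b0 z Tz.
  have b0' := lt_le_trans y0 yz.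
  have -> : triangle_weight i j k z * (1 - x * z.1 - y * z.2) `^ (- al) =
    triangle_weight i j k z * (1 - y * z.2) `^ (- al)
     * (1 - x * z.1 / (1 - y * z.2)) `^ (- al).
    rewrite -mulrA -powRM ?(ltW b0')//; last first.
      by rewrite subr_ge0 (le_trans (ler_norm _))// (le_trans (q1 z Tz))// ltW.
    by congr (_ * _ `^ _); field; rewrite gt_eqF.
  rewrite seriesE//.
  apply: cvgM; [exact: cvg_cst|apply: cvg_binomial_series => //].
  exact: le_lt_trans (q1 z Tz) x1.
Qed.

Lemma lim_seriesZ {R : realType} (r : R) (u : nat -> R) (l : R) :
  series u @ \oo --> l -> limn (series (fun n => r * u n)) = r * l.
Proof.
move=> ul; have -> : series (fun n => r * u n) = (fun N => r * series u N).
  by apply/funext => N; rewrite /series/= mulr_sumr.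
by apply/cvg_lim => //; apply: cvgM => //; exact: cvg_cst.
Qed.

Lemma appellF1_seriesE {R : realType} (i j k : nat) (al x y : R) :
  0 < al -> `|x| < 1 -> `|y| < 1 ->
  appellF1_series al i.+1%:R j.+1%:R (i + j + k).+3%:R x y
  = (i + j + k).+2`!%:R / (i`! * j`! * k`!)%:R * euler_integral i j k al x y.
Proof.
move=> al0 x1 y1; rewrite /appellF1_series.
under eq_fun => p.
  under eq_fun => q do rewrite appell_termE.
  rewrite (lim_seriesZ _ _ _ (cvg_appell_inner i j k p al x y al0 x1 y1)).
  over.
exact: lim_seriesZ (cvg_appell_outer i j k al x y al0 x1 y1).
Qed.

Lemma appellF1_integralE {R : realType} (i j k : nat) (al x y : R) :
  appellF1_integral al i.+1%:R j.+1%:R (i + j + k).+3%:R x y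
  = (i + j + k).+2`!%:R / (i`! * j`! * k`!)%:R * euler_integral i j k al x y.
Proof.
have -> : appellF1_integral al i.+1%:R j.+1%:R (i + j + k).+3%:R x y =
    Gamma (i + j + k).+3%:R / (Gamma i.+1%:R * Gamma j.+1%:R * Gamma k.+1%:R)
    * euler_integral i j k al x y.
  rewrite /appellF1_integral /euler_integral.
  have -> : (i + j + k).+3%:R - i.+1%:R - j.+1%:R = k.+1%:R :> R.
    by rewrite -!natr1 !natrD; ring.
  congr (_ * _); apply: eq_Rintegral => z /set_mem Tz.
  have [/andP[z10 _] /andP[z20 _] /andP[z30 _]] := triangle_le1 z Tz.
  have pred1 n : n.+1%:R - 1 = n%:R :> R by rewrite -natr1 addrK.
  by rewrite !pred1 !powR_mulrn.
by rewrite !Gamma_nat !natrM.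
Qed.

(** Outside the square |x|, |y| < 1 this is the definition of F_1, with the Gamma
    values at positive integers written as factorials. *)
Lemma appellF1E {R : realType} (i j k : nat) (al x y : R) : 0 < al ->
  appellF1 al i.+1%:R j.+1%:R (i + j + k).+3%:R x y
  = (i + j + k).+2`!%:R / (i`! * j`! * k`!)%:R * euler_integral i j k al x y.
Proof.
move=> al0; rewrite /appellF1; case: ifPn => [/andP[x1 y1]|_].
  exact: appellF1_seriesE.
exact: appellF1_integralE.
Qed.

(** * Differentiating Euler's integral *)

(** One statement for both variables: [h] is the coordinate that multiplies the
    variable t, and [g] collects what does not depend on t.  A lower bound for
    the base at a parameter t1 beyond t0 holds for all smaller parameters,
    because h is nonnegative; it makes a constant dominate the derivatives near
    t0. *)
Lemma is_derive_under_triangle {R : realType} (w g h : R * R -> R)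
    (al t0 t1 d : R) :
  0 < al -> t0 < t1 -> 0 < d ->
  measurable_fun triangle w -> measurable_fun triangle g ->
  measurable_fun triangle h ->
  (forall z, triangle z -> 0 <= w z <= 1) ->
  (forall z, triangle z -> 0 <= h z <= 1) ->
  (forall z, triangle z -> d <= g z - t1 * h z) ->
  is_derive t0 1 (fun t =>
    \int[lebesgue2 R]_(z in triangle)
      (w z * (g z - t * h z) `^ (- al)))
   (al * \int[lebesgue2 R]_(z in triangle)
      (w z * h z * (g z - t0 * h z) `^ (- (al + 1)))).
Proof.
move=> al0 t01 d0 mw mg mh w01 h01 gd.
pose f (t : R) (z : R * R) := w z * (g z - t * h z) `^ (- al).
pose df (t : R) (z : R * R) := al * (w z * h z * (g z - t * h z) `^ (- (al + 1))).
have gtd (t : R) (z : R * R) : t < t1 -> triangle z -> d <= g z - t * h z.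
  move=> tt1 Tz; apply: le_trans (gd z Tz) _; rewrite lerD2l lerN2.
  by rewrite ler_wpM2r// ?(ltW tt1)//; have /andP[] := h01 z Tz.
have mf (r : R) (v : R * R -> R) (t : R) : measurable_fun triangle v ->
    measurable_fun triangle (fun z => v z * (g z - t * h z) `^ r).
  move=> mv; apply: measurable_funM => //.
  apply: (@measurableT_comp _ _ _ _ _ _ (fun t : R => t `^ r)).
    exact: measurable_powR.
  by apply: measurable_funB => //; apply: measurable_funM.
have intf (r : R) (v : R * R -> R) (t : R) : 0 <= r -> t < t1 -> measurable_fun triangle v ->
    (forall z, triangle z -> 0 <= v z <= 1) ->
    (lebesgue2 R).-integrable triangle
      (EFin \o (fun z => v z * (g z - t * h z) `^ (- r))).
  move=> r0 tt1 mv v01; apply: (@bounded_integrable _ _ _ _ _ _ (d `^ (- r))).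
  - exact: measurable_triangle.
  - exact: triangle_lty.
  - exact: mf.
  move=> z Tz; have /andP[v0 v1] := v01 z Tz.
  rewrite ger0_norm ?mulr_ge0 ?powR_ge0//.
  by rewrite -[leRHS]mul1r ler_pM ?powR_ge0// powRN_le// gtd.
have dfE (t : R) (z : R * R) : t < t1 -> triangle z -> is_derive t 1 (f ^~ z) (df t z).
  move=> tt1 Tz; have b0 : 0 < g z - t * h z by exact: lt_le_trans (gtd t z tt1 Tz).
  have h2 : is_derive t 1 (fun t : R => g z - t * h z) (- h z).
    by apply: is_derive_eq; rewrite /GRing.scale/=; ring.
  have h3 := @is_derive1_comp _ (fun x => x `^ (- al)) (fun t => g z - t * h z) _ _ _
    (is_derive1_powR (- al) b0) h2.
  have h4 := is_deriveZ (w z) h3.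
  apply: (is_derive_eq h4).
  by rewrite /GRing.scale/= /df opprD; ring.
have I0 : `]t0 - 1, t1[%classic t0.
  by rewrite /= in_itv/= t01 andbT ltrBlDr ltrDl.
have It (t : R) : `]t0 - 1, t1[%classic t -> t < t1.
  by rewrite /= in_itv/= => /andP[].
have wh01 (z : R * R) : triangle z -> 0 <= w z * h z <= 1.
  move=> Tz; have /andP[w0 w1] := w01 z Tz; have /andP[h0 h1] := h01 z Tz.
  by rewrite mulr_ge0// mulr_ile1.
have mwh : measurable_fun triangle (fun z => w z * h z) by exact: measurable_funM.
have al1 : 0 <= al + 1 by rewrite addr_ge0// ltW.
have H1 (t : R) : `]t0 - 1, t1[%classic t ->
    (lebesgue2 R).-integrable triangle (EFin \o f t).
  by move=> /It tt1; apply: intf => //; exact: ltW.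
have H2 (t : R) (z : R * R) : `]t0 - 1, t1[%classic t -> triangle z -> derivable (f ^~ z) t 1.
  by move=> /It tt1 Tz; have [] := dfE t z tt1 Tz.
have H3 (z : R * R) : 0 <= cst (al * d `^ (- (al + 1))) z.
  by rewrite /= mulr_ge0 ?powR_ge0// ltW.
have H4 : (lebesgue2 R).-integrable triangle
    (EFin \o cst (al * d `^ (- (al + 1)))).
  apply: (@bounded_integrable _ _ _ _ _ _ `|al * d `^ (- (al + 1))|) => //.
  - exact: measurable_triangle.
  - exact: triangle_lty.
have E (t : R) (z : R * R) : t < t1 -> triangle z -> partial1of2 f t z = df t z.
  by move=> tt1 Tz; rewrite partial1of2E; have [_ ->] := dfE t z tt1 Tz.
have H5 (t : R) (z : R * R) : `]t0 - 1, t1[%classic t -> triangle z ->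
    `|partial1of2 f t z| <= cst (al * d `^ (- (al + 1))) z.
  move=> /It tt1 Tz; rewrite E// /df /= normrM (gtr0_norm al0).
  have /andP[v0 v1] := wh01 z Tz.
  rewrite ler_wpM2l ?(ltW al0)// ger0_norm ?(mulr_ge0 v0) ?powR_ge0//.
  by rewrite -[leRHS]mul1r ler_pM ?powR_ge0// powRN_le// gtd.
pose F t := \int[lebesgue2 R]_(z in triangle)
  f t z.
have D1 : derivable F t0 1.
  apply: (derivable_under_integral _ I0 H1 H2 H3 H4 H5).
  exact: measurable_triangle.
have D2 : derive1 F t0 =
    \int[lebesgue2 R]_(z in triangle)
    partial1of2 f t0 z.
  apply: (differentiation_under_integral _ I0 H1 H2 H3 H4 H5).
  exact: measurable_triangle.
apply: DeriveDef; first exact: D1.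
rewrite -derive1E -/F D2 -RintegralZl; last 2 first.
- exact: measurable_triangle.
- exact: intf.
by apply: eq_Rintegral => z /set_mem Tz; rewrite E.
Qed.

Lemma is_derive_euler_x {R : realType} (i j k : nat) (al x y : R) :
  0 < al -> x < 1 -> y < 1 ->
  is_derive x 1 (fun t => euler_integral i j k al t y)
    (al * euler_integral i.+1 j k (al + 1) x y).
Proof.
move=> al0 x1 y1.
have [x2 [xx2 x21]] : exists x2, x < x2 /\ x2 < 1 by exists ((x + 1) / 2); split; lra.
have [r [r0 r1 xr yr]] := max_lt1 x2 y x21 y1.
have H := @is_derive_under_triangle R (triangle_weight i j k)
  (fun z => 1 - y * z.2) (fun z => z.1) al x x2 (1 - r) al0 xx2.
have -> : (fun t => euler_integral i j k al t y) = (fun t =>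
    \int[lebesgue2 R]_(z in triangle)
      (triangle_weight i j k z * (1 - y * z.2 - t * z.1) `^ (- al))).
  apply/funext => t; apply: eq_Rintegral => z _.
  by rewrite addrAC.
have -> : euler_integral i.+1 j k (al + 1) x y =
    \int[lebesgue2 R]_(z in triangle)
      (triangle_weight i j k z * z.1 * (1 - y * z.2 - x * z.1) `^ (- (al + 1))).
  apply: eq_Rintegral => z _; rewrite [in RHS]addrAC; congr (_ * _).
  by rewrite /triangle_weight exprS; ring.
apply: H; rewrite ?subr_gt0//.
- exact: measurable_triangle_weight.
- by apply: measurable_funTS; apply: measurable_funB => //; apply: measurable_funM.
- by apply: measurable_funTS; exact: measurable_fst.
- by move=> z Tz; rewrite triangle_weight_ge0// triangle_weight_le1.
- by move=> z /triangle_le1[].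
- by move=> z Tz; rewrite addrAC; exact: triangle_base_ge.
Qed.

Lemma is_derive_euler_y {R : realType} (i j k : nat) (al x y : R) :
  0 < al -> x < 1 -> y < 1 ->
  is_derive y 1 (fun t => euler_integral i j k al x t)
    (al * euler_integral i j.+1 k (al + 1) x y).
Proof.
move=> al0 x1 y1.
have [y2 [yy2 y21]] : exists y2, y < y2 /\ y2 < 1 by exists ((y + 1) / 2); split; lra.
have [r [r0 r1 xr yr]] := max_lt1 x y2 x1 y21.
have -> : euler_integral i j.+1 k (al + 1) x y =
    \int[lebesgue2 R]_(z in triangle)
      (triangle_weight i j k z * z.2 * (1 - x * z.1 - y * z.2) `^ (- (al + 1))).
  apply: eq_Rintegral => z _; congr (_ * _).
  by rewrite /triangle_weight exprS; ring.
apply: (@is_derive_under_triangle R (triangle_weight i j k)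
  (fun z => 1 - x * z.1) (fun z => z.2) al y y2 (1 - r)) => //.
- by rewrite subr_gt0.
- exact: measurable_triangle_weight.
- by apply: measurable_funTS; apply: measurable_funB => //; apply: measurable_funM.
- by apply: measurable_funTS; exact: measurable_snd.
- by move=> z Tz; rewrite triangle_weight_ge0// triangle_weight_le1.
- by move=> z /triangle_le1[].
- by move=> z Tz; exact: triangle_base_ge.
Qed.

(** * Relations between the integrals *)

(** One factor of (1 - x z.1 - y z.2)^(- al) is split off and the terms x z.1 and
    y z.2 are absorbed in the weight. *)
Lemma euler_integral_contiguous {R : realType} (i j k : nat) (al x y : R) :
  0 <= al -> x < 1 -> y < 1 ->
  euler_integral i j k (al + 1) x y =
  euler_integral i j k al x y + x * euler_integral i.+1 j k (al + 1) x y
   + y * euler_integral i j.+1 k (al + 1) x y.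
Proof.
move=> al0 x1 y1; have mT := @measurable_triangle R.
have al1 : 0 <= al + 1 by rewrite addr_ge0.
have i0 := integrable_euler_integrand i j k al x y al0 x1 y1.
pose g (i j : nat) (z : R * R) :=
  triangle_weight i j k z * (1 - x * z.1 - y * z.2) `^ (- (al + 1)).
have iZ r (i' j' : nat) : (lebesgue2 R).-integrable
    triangle (EFin \o (fun z => r * g i' j' z)).
  apply: integrable_EFinZl; first exact: mT.
  exact: integrable_euler_integrand.
have iD : (lebesgue2 R).-integrable triangle
    (EFin \o (fun z => triangle_weight i j k z
       * (1 - x * z.1 - y * z.2) `^ (- al) + x * g i.+1 j z)).
  by apply: integrable_EFinD; [exact: mT|exact: i0|exact: iZ].
rewrite /euler_integral -!RintegralZl//; last 2 first.
- exact: integrable_euler_integrand.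
- exact: integrable_euler_integrand.
rewrite -RintegralD//; last exact: iZ.
rewrite -RintegralD//; last exact: iZ.
apply: eq_Rintegral => z /set_mem Tz.
have b0 := triangle_base_gt0 x y z x1 y1 Tz.
have -> : (1 - x * z.1 - y * z.2) `^ (- al) =
    (1 - x * z.1 - y * z.2) * (1 - x * z.1 - y * z.2) `^ (- (al + 1)).
  rewrite -[X in _ = X * _](powRr1 (ltW b0)) -powRD ?(gt_eqF b0) ?implybT//.
  by congr (_ `^ _); ring.
by rewrite /triangle_weight !exprS; ring.
Qed.

(** The base 1 - x z.1 - y z.2 is at most 1 + |x| + |y| on the triangle, so the
    integral is at least a positive multiple of Dirichlet's integral. *)
Lemma euler_integral_gt0 {R : realType} (i j k : nat) (al x y : R) :
  0 <= al -> x < 1 -> y < 1 -> 0 < euler_integral i j k al x y.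
Proof.
move=> al0 x1 y1; have mT := @measurable_triangle R.
pose C := 1 + `|x| + `|y|.
have C0 : 0 < C by rewrite !ltr_wpDr.
have iw : (lebesgue2 R).-integrable triangle
    (EFin \o triangle_weight i j k).
  apply: (@bounded_integrable _ _ _ _ _ _ 1) => //.
  - exact: triangle_lty.
  - exact: measurable_triangle_weight.
  - by move=> z Tz; rewrite ger0_norm ?triangle_weight_ge0 ?triangle_weight_le1.
apply: (@lt_le_trans _ _ (\int[lebesgue2 R]_(z in triangle)
  (C `^ (- al) * triangle_weight i j k z))).
  rewrite RintegralZl// dirichlet_triangle.
  by rewrite mulr_gt0 ?powR_gt0// divr_gt0// ltr0n ?muln_gt0 ?fact_gt0.
apply: le_Rintegral => //.
- exact: integrable_EFinZl.
- exact: integrable_euler_integrand.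
move=> z Tz; rewrite mulrC ler_wpM2l ?triangle_weight_ge0// powRN_le//.
  exact: triangle_base_gt0.
have [/andP[z10 z11] /andP[z20 z21] _] := triangle_le1 z Tz.
rewrite /C lerD// ?lerD2l.
  rewrite -mulNr (le_trans (ler_norm _))// normrM normrN -[leRHS]mulr1.
  by rewrite ler_wpM2l// ger0_norm.
rewrite -mulNr (le_trans (ler_norm _))// normrM normrN -[leRHS]mulr1.
by rewrite ler_wpM2l// ger0_norm.
Qed.

(** * The functions Htilde *)

Lemma dtilde_ge1 {R : realType} (a b c m : nat) :
  (0 < a)%N -> (0 < b)%N -> (0 < c)%N -> 1 <= dtilde R a b c m.
Proof.
move=> a0 b0 c0; rewrite /dtilde.
have : 1 <= a%:R :> R by rewrite ler1n.
have : 1 <= b%:R :> R by rewrite ler1n.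
have : 1 <= c%:R :> R by rewrite ler1n.
have : 0 <= m%:R :> R by [].
lra.
Qed.

Lemma HtildeE {R : realType} (a b c m : nat) (u v : R) :
  Htilde a.+1 b.+1 c.+1 u v m =
  Gamma (dtilde R a.+1 b.+1 c.+1 m) / (c`! * b`! * a`!)%:R
  * euler_integral c b a (dtilde R a.+1 b.+1 c.+1 m) u v.
Proof.
have d0 : 0 < dtilde R a.+1 b.+1 c.+1 m.
  by rewrite (lt_le_trans _ (dtilde_ge1 a.+1 b.+1 c.+1 m _ _ _)).
have abc : a.+1%:R + b.+1%:R + c.+1%:R = (c + b + a).+3%:R :> R.
  by rewrite -!natr1 !natrD; ring.
rewrite /Htilde abc appellF1E// Gamma_nat.
have : (c + b + a).+2`!%:R != 0 :> R by rewrite pnatr_eq0 -lt0n fact_gt0.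
set p := _`!%:R => p0; rewrite mulrA; congr (_ * _).
by rewrite mulrA divfK.
Qed.

Lemma dtildeD2 {R : realType} (a b c m : nat) :
  dtilde R a b c (m + 2) = dtilde R a b c m + 1.
Proof. by rewrite /dtilde natrD; field. Qed.

Lemma dtildeS {R : realType} (a b c m : nat) :
  (dtilde R a.+1 b c m = dtilde R a b c m + 1) *
  (dtilde R a b.+1 c m = dtilde R a b c m + 1) *
  (dtilde R a b c.+1 m = dtilde R a b c m + 1).
Proof. by rewrite /dtilde -!natr1; split; [split|]; ring. Qed.

Theorem proposition2p6 (R : realType) (a b c m : nat)
    (ha : (0 < a)%N) (hb : (0 < b)%N) (hc : (0 < c)%N) (hm : (0 < m)%N)
    (u v : R) (hu : u < 1) (hv : v < 1) :
  (* the partial derivatives exist *)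
  (derivable (fun x : R => Htilde a b c x v m) u 1 /\
   derivable (fun y : R => Htilde a b c u y m) v 1) /\
  Htilde a b c u v (m + 2) =
    dtilde R a b c m * Htilde a b c u v m
    + u * derive1 (fun x : R => Htilde a b c x v m) u
    + v * derive1 (fun y : R => Htilde a b c u y m) v /\
  Htilde a (b + 1) c u v m =
    b%:R^-1 * derive1 (fun y : R => Htilde a b c u y m) v /\
  Htilde a b (c + 1) u v m =
    c%:R^-1 * derive1 (fun x : R => Htilde a b c x v m) u /\
  (* the denominators of the quotients do not vanish *)
  (Htilde a b c u v m != 0 /\
   appellF1 (dtilde R a b c m) c%:R b%:R (a%:R + b%:R + c%:R) u v != 0) /\
  Htilde (a + 1) b c u v m / Htilde a b c u v m =
    dtilde R a b c m / (a%:R + b%:R + c%:R) *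
    (appellF1 (dtilde R a b c m + 1) c%:R b%:R (a%:R + b%:R + c%:R + 1) u v
     / appellF1 (dtilde R a b c m) c%:R b%:R (a%:R + b%:R + c%:R) u v).
Proof.
have {ha} [a' ->] : exists a', a = a'.+1 by exists a.-1; rewrite prednK.
have {hb} [b' ->] : exists b', b = b'.+1 by exists b.-1; rewrite prednK.
have {hc} [c' ->] : exists c', c = c'.+1 by exists c.-1; rewrite prednK.
move: a' b' c' => {}a {}b {}c.
set d := dtilde R a.+1 b.+1 c.+1 m.
have d1 : 1 <= d by exact: dtilde_ge1.
have d0 : 0 < d by exact: lt_le_trans d1.
have fact_neq0 n : n`!%:R != 0 :> R by rewrite pnatr_eq0 -lt0n fact_gt0.
have Gd : Gamma (d + 1) = d * Gamma d by exact: GammaS.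
pose K : R := Gamma d / (c`! * b`! * a`!)%:R.
have G0 : 0 < Gamma d by exact: Gamma_gt0.
have K0 : 0 < K by rewrite divr_gt0// ltr0n !muln_gt0 !fact_gt0.
have du : is_derive u 1 (fun x => Htilde a.+1 b.+1 c.+1 x v m)
    (K * (d * euler_integral c.+1 b a (d + 1) u v)).
  have -> : (fun x => Htilde a.+1 b.+1 c.+1 x v m) =
      K *: (fun x => euler_integral c b a d x v).
    by apply/funext => x; rewrite HtildeE.
  by apply: is_deriveZ; exact: is_derive_euler_x.
have dv : is_derive v 1 (fun y => Htilde a.+1 b.+1 c.+1 u y m)
    (K * (d * euler_integral c b.+1 a (d + 1) u v)).
  have -> : (fun y => Htilde a.+1 b.+1 c.+1 u y m) =
      K *: (fun y => euler_integral c b a d u y).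
    by apply/funext => y; rewrite HtildeE.
  by apply: is_deriveZ; exact: is_derive_euler_y.
have E0 : 0 < euler_integral c b a d u v by apply: euler_integral_gt0 => //; exact: ltW.
have F0 : appellF1 d c.+1%:R b.+1%:R (a.+1%:R + b.+1%:R + c.+1%:R) u v != 0.
  have -> : a.+1%:R + b.+1%:R + c.+1%:R = (c + b + a).+3%:R :> R.
    by rewrite -!natr1 !natrD; ring.
  rewrite appellF1E// gt_eqF// mulr_gt0// divr_gt0// ltr0n ?muln_gt0 ?fact_gt0//.
split; first by split; [case: du|case: dv].
have du' : derive1 (fun x => Htilde a.+1 b.+1 c.+1 x v m) u =
    K * (d * euler_integral c.+1 b a (d + 1) u v).
  by rewrite derive1E; case: du.
have dv' : derive1 (fun y => Htilde a.+1 b.+1 c.+1 u y m) v =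
    K * (d * euler_integral c b.+1 a (d + 1) u v).
  by rewrite derive1E; case: dv.
rewrite !addn1.
have natM (p q : nat) : (p * q)%:R = p%:R * q%:R :> R by exact: natrM.
have [[dSa dSb] dSc] := @dtildeS R a.+1 b.+1 c.+1 m.
split; last split; last split; last split.
- rewrite [X in u * X]du' [X in v * X]dv' 2!HtildeE dtildeD2 -/d Gd.
  rewrite (euler_integral_contiguous c b a d u v (ltW d0) hu hv) -/K.
  have -> : d * Gamma d / (c`! * b`! * a`!)%:R = d * K by rewrite mulrA.
  (* With the integrals as atoms, [ring] does not compare them by unfolding. *)
  move: K (euler_integral _ _ _ _ _ _) (euler_integral _ _ _ _ _ _)
    (euler_integral _ _ _ _ _ _) {K0 du dv du' dv'} => K I Iu Iv.
  ring.
- rewrite [X in _ * X]dv' HtildeE dSb -/d Gd /K factS !natM; field.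
  by rewrite !fact_neq0 nat1r pnatr_eq0.
- rewrite [X in _ * X]du' HtildeE dSc -/d Gd /K factS !natM; field.
  by rewrite !fact_neq0 nat1r pnatr_eq0.
- split; last exact: F0.
  by rewrite HtildeE gt_eqF// mulr_gt0.
- have S1 : 1 <= a.+1%:R + b.+1%:R + c.+1%:R :> R.
    by rewrite -!natrD ler1n.
  have GS := Gamma_gt0 _ S1.
  have S0 : 0 < a.+1%:R + b.+1%:R + c.+1%:R :> R by exact: lt_le_trans S1.
  rewrite /Htilde dSa -/d.
  have -> : a.+2%:R + b.+1%:R + c.+1%:R = a.+1%:R + b.+1%:R + c.+1%:R + 1 :> R.
    by rewrite -(natr1 a.+1); ring.
  rewrite Gd GammaS//.
  move: F0 GS G0 S0 {du dv du' dv' K K0 Gd S1}.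
  move: (appellF1 (d + 1) _ _ _ _ _) (appellF1 d _ _ _ _ _) => F' F.
  move: (Gamma d) => Gd; move: (Gamma _) => GS; move: (a.+1%:R + _ + _) => S.
  move=> F0 GS0 Gd0 S0.
  by field; rewrite F0 !gt_eqF.
Qed.
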